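(* Let $k,r$ be positive integers and $h=3$, such that $\ell=\frac{k+3}{r}$ is an integer. Let $m$ be the smallest even integer such that $\ell\le 2^{rm}$. Then there exists a maximally recoverable local $(k,r,3)$-code over the field $\mathbb{F}_{2^t}$, where $t=r\left(\frac{3m}{2}+1\right)$.
   Context: For positive integers $k,r,h$ with $r\mid(k+h)$, a local $(k,r,h)$-code over a finite field $\mathbb{F}$ is a linear systematic code of dimension $k$ and length $k+h+\frac{k+h}{r}$ consisting of $k$ data symbols, $h$ heavy parity symbols (each a fixed $\mathbb{F}$-linear combination of all data symbols), and, after partitioning the $k+h$ data and heavy parity symbols into $\frac{k+h}{r}$ groups of size $r$, one local parity per group equal to the sum (XOR) of the group's symbols. A local group is such a group together with its local parity. The code is maximally recoverable if for every set $E$ of coordinates containing exactly one coordinate from each local group, puncturing the code in $E$ yields a maximum distance separable $[k+h,k]$ code (minimum distance $h+1$). *)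

(* Defs.v *)
From HB Require Import structures.
From mathcomp Require Import all_boot all_order all_algebra all_field.
Set Implicit Arguments. Unset Strict Implicit. Unset Printing Implicit Defensive.
Import GRing.Theory.
Local Open Scope ring_scope.

Definition wt (F : fieldType) (n : nat) (c : 'rV[F]_n) : nat :=
  #|[set i : 'I_n | c 0 i != 0]|.

Definition min_dist_is (F : fieldType) (k n : nat) (G : 'M[F]_(k, n)) (d : nat) : Prop :=
  (forall c : 'rV[F]_n, (c <= G)%MS -> c != 0 -> (d <= wt c)%N) /\
  (exists c : 'rV[F]_n, [/\ (c <= G)%MS, c != 0 & wt c = d]).

Definition MDS_code (F : fieldType) (k n : nat) (G : 'M[F]_(k, n)) : Prop :=
  \rank G = k /\ min_dist_is G (n - k + 1).

(* A local (k,r,h)-code is determined by the heavy parity coefficients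
   Hp : 'M_(k,h) (heavy parity j = \sum_i Hp i j * x_i) and by the grouping
   g : 'I_(k+h) -> 'I_l  (l = (k+h)/r) of data+heavy symbols into local groups. *)
Definition nlocal (k r h : nat) : nat := ((k + h) %/ r)%N.

Definition valid_grouping (k r h : nat) (g : 'I_(k + h) -> 'I_(nlocal k r h)) : Prop :=
  forall j : 'I_(nlocal k r h), #|[set i | g i == j]| = r.

(* generator matrix: x |-> (x, x*Hp, local parities) *)
Definition local_gen (F : fieldType) (k r h : nat) (Hp : 'M[F]_(k, h))
    (g : 'I_(k + h) -> 'I_(nlocal k r h)) : 'M[F]_(k, k + h + nlocal k r h) :=
  let S := row_mx (1%:M : 'M[F]_k) Hp in
  row_mx S (S *m \matrix_(i < k + h, j < nlocal k r h) ((g i == j)%:R : F)).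

Definition local_group (k r h : nat) (g : 'I_(k + h) -> 'I_(nlocal k r h))
    (j : 'I_(nlocal k r h)) : {set 'I_(k + h + nlocal k r h)} :=
  [set lshift (nlocal k r h) i | i in [set i | g i == j]] :|: [set rshift (k + h) j].

Definition puncture (F : fieldType) (k n : nat) (G : 'M[F]_(k, n)) (E : {set 'I_n})
  : 'M[F]_(k, #|~: E|) := colsub (fun i : 'I_#|~: E| => enum_val i) G.

Definition maximally_recoverable (F : fieldType) (k r h : nat) (Hp : 'M[F]_(k, h))
    (g : 'I_(k + h) -> 'I_(nlocal k r h)) : Prop :=
  forall E : {set 'I_(k + h + nlocal k r h)},
    (forall j, #|E :&: local_group g j| = 1%N) ->
    #|~: E| = (k + h)%N /\ MDS_code (puncture (local_gen Hp g) E).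

(* Main.v *)
(** Give the symbol at position [i] of group [s] the label
    [(b_i, b_i x_s, b_i N(x_s))], where [b_1, ..., b_r] is a basis of GF(q) over
    GF(2), [q = 2^r], the [x_s] are distinct elements of GF(Q^2), [Q = q^(m/2)],
    and [N(x) = x^(Q+1)]; local parities get label 0.  Labels live in
    GF(q) x GF(Q^2) x GF(Q), which is additively isomorphic to GF(2^t).  The heavy
    parities are chosen so that [\sum_w c_w a_w^(2^j) = 0] for [j = 0, 1, 2].
    Puncturing one symbol [e] per group replaces [a_w] by [a_w + a_e] in these
    equations, so a nonzero punctured codeword of weight at most 3 would make
    a 3 x 3 Moore determinant vanish, that is, make a subset sum of at most three
    of the [a_w + a_e] vanish.  Inside a group this contradicts the
    independence of the [b_i]; across groups it would put three of the points
    [(x_s, N(x_s))] on a line over GF(q), but these points form an elliptic paraboloid,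
    which is a cap. *)
Require Import Defs.
From HB Require Import structures.
From mathcomp Require Import all_boot all_order all_algebra all_fingroup all_solvable all_field.
From mathcomp Require Import ring.
Set Implicit Arguments. Unset Strict Implicit. Unset Printing Implicit Defensive.
Import GRing.Theory.
Local Open Scope ring_scope.

(** * Moore determinants of order three *)

Lemma moore3_last (F : fieldType) (x y z a b c : F) :
  x != 0 -> y != 0 -> z != 0 -> x != y -> x != z -> y != z -> x + y + z != 0 ->
  a * x + b * y + c * z = 0 ->
  a * x ^+ 2 + b * y ^+ 2 + c * z ^+ 2 = 0 ->
  a * x ^+ 4 + b * y ^+ 4 + c * z ^+ 4 = 0 -> c = 0.
Proof.
move=> x0 y0 z0 xy xz yz xyz e1 e2 e4.
(* The determinant of [[x, y, z], [x^2, y^2, z^2], [x^4, y^4, z^4]] is the product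
   multiplying [c], over any commutative ring; this is Cramer's rule for [c]. *)
have : c * (x * y * z * (y - x) * (z - x) * (z - y) * (x + y + z)) =
  (a * x + b * y + c * z) * (x ^+ 2 * y ^+ 4 - x ^+ 4 * y ^+ 2)
  - (a * x ^+ 2 + b * y ^+ 2 + c * z ^+ 2) * (x * y ^+ 4 - x ^+ 4 * y)
  + (a * x ^+ 4 + b * y ^+ 4 + c * z ^+ 4) * (x * y ^+ 2 - x ^+ 2 * y) by ring.
rewrite e1 e2 e4 !mul0r subr0 addr0 => /eqP.
rewrite !mulf_eq0 !subr_eq0 (negPf x0) (negPf y0) (negPf z0) (negPf xyz).
by rewrite ![y == _]eq_sym ![z == _]eq_sym (negPf xy) (negPf xz) (negPf yz) !orbF => /eqP.
Qed.

Lemma moore3 (F : fieldType) (x y z a b c : F) :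
  x != 0 -> y != 0 -> z != 0 -> x != y -> x != z -> y != z -> x + y + z != 0 ->
  a * x + b * y + c * z = 0 ->
  a * x ^+ 2 + b * y ^+ 2 + c * z ^+ 2 = 0 ->
  a * x ^+ 4 + b * y ^+ 4 + c * z ^+ 4 = 0 -> [/\ a = 0, b = 0 & c = 0].
Proof.
move=> x0 y0 z0 xy xz yz xyz e1 e2 e4; split; last exact: moore3_last e4.
- by apply: (@moore3_last _ y z x b c a); rewrite // 1?[y == x]eq_sym 1?[z == x]eq_sym // addrC addrA.
- by apply: (@moore3_last _ x z y a c b); rewrite // 1?[z == y]eq_sym // addrAC.
Qed.

(** * Weights and the MDS property *)

(** The weight bound already forces encoding to be injective, hence full rank. The distance is
    attained by the Singleton argument: a nonzero message can be chosen whose codeword vanishes on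
    [k.-1] prescribed coordinates. *)
Lemma MDS_code_of_wt (F : fieldType) (k n : nat) (G : 'M[F]_(k, n)) :
  (0 < k)%N -> (k <= n)%N ->
  (forall x : 'rV[F]_k, x != 0 -> (n - k < wt (x *m G))%N) -> MDS_code G.
Proof.
move=> k0 kn wtG.
have inj (x : 'rV_k) : x *m G = 0 -> x = 0.
  move=> xG; case: (eqVneq x 0) => // x0; have := wtG x x0; rewrite xG /wt.
  by rewrite eq_card0 // => i; rewrite !inE mxE eqxx.
have rkG : \rank G = k.
  by apply/eqP; rewrite -[_ == _]/(row_free G); apply: inj_row_free.
split=> //; split=> [c|].
  case/submxP=> x -> xG0; rewrite addn1; apply: wtG.
  by apply: contraNneq xG0 => ->; rewrite mul0mx.
have lt_k (i : 'I_k.-1) : (i < n)%N.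
  by apply: leq_trans (ltn_ord i) (leq_trans (leq_pred k) kn).
(* [A] consists of the first [k.-1] columns, so its left kernel is nonzero; a kernel vector encodes
   to a word supported on the other [n - k + 1] coordinates. *)
pose A := colsub (fun i => Ordinal (lt_k i)) G.
have : kermx A != 0.
  rewrite kermx_eq0 /row_free neq_ltn; apply/orP; left.
  by apply: leq_ltn_trans (rank_leq_col A) _; rewrite prednK.
case/rowV0Pn=> x /sub_kermxP xA x0; exists (x *m G).
have le_wt : (wt (x *m G) <= n - k + 1)%N.
  rewrite /wt; set W := [set i | _].
  have : W \subset [set i : 'I_n | k.-1 <= i]%N.
    apply/subsetP=> i; rewrite !inE; apply: contraR; rewrite -ltnNge => ik.
    move/rowP/(_ (Ordinal ik)): xA; rewrite !mxE => xA.
    apply/eqP; rewrite -[RHS]xA; apply: eq_bigr => j _.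
    by rewrite [in RHS]mxE; congr (_ * G _ _); apply: val_inj.
  move/subset_leq_card/leq_trans; apply.
  have -> : [set i : 'I_n | k.-1 <= i]%N =
      ~: [set widen_ord (leq_trans (leq_pred k) kn) i | i in 'I_k.-1].
    apply/setP=> i; rewrite !inE leqNgt; congr negb.
    apply/idP/imsetP => [ik|[j _ ->]]; last exact: (ltn_ord j).
    by exists (Ordinal ik) => //; apply: val_inj.
  rewrite cardsCs setCK card_ord card_imset ?card_ord => [|i j [ij]]; last exact: val_inj.
  by rewrite addn1 -subSn // -{2}(prednK k0) subSS.
split; first exact: submxMl.
  by apply: contraNneq x0 => /inj ->.
by apply/eqP; rewrite eqn_leq le_wt addn1 wtG.
Qed.

Lemma intermediate_card (T : finType) (A B : {set T}) (d : nat) :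
  A \subset B -> (#|A| + d <= #|B|)%N ->
  exists W : {set T}, [/\ A \subset W, W \subset B & #|W| = #|A| + d]%N.
Proof.
elim: d A => [|d IH] A AB cardAB; first by exists A; rewrite addn0.
have /properP[_ [x xB xA]] : A \proper B.
  by rewrite properEcard AB (leq_trans _ cardAB) // addnS ltnS leq_addr.
have cardxA : #|x |: A| = #|A|.+1 by rewrite cardsU1 xA.
case: (IH (x |: A)); rewrite ?subUset ?sub1set ?xB ?cardxA ?addSnnS //.
by move=> W []; rewrite subUset => /andP[_ AW] WB cW; exists W.
Qed.

(** * Independent labels and codewords of low weight *)

Lemma exprD_pchar2 (F : fieldType) (x y : F) (t : nat) :
  2%N \in [pchar F] -> (x + y) ^+ (2 ^ t) = x ^+ (2 ^ t) + y ^+ (2 ^ t).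
Proof.
by move=> F2; apply: exprDn_pchar; rewrite (eq_pnat _ (pcharf_eq F2)) pnatX pnat_id.
Qed.

(** [e] selects the punctured symbol of each group. In characteristic 2 the three conclusions say
    that sums of one, two and three shifted labels are nonzero; as the triple is ordered
    arbitrarily, one sum of each size suffices. *)
Definition independent_labels (F : fieldType) (T J : finType) (grp : T -> J) (a : T -> F) : Prop :=
  forall e : J -> T, (forall j, grp (e j) = j) ->
  let c w := a w + a (e (grp w)) in
  forall w1 w2 w3 : T, uniq [:: w1; w2; w3] ->
    w1 != e (grp w1) -> w2 != e (grp w2) -> w3 != e (grp w3) ->
  [/\ c w1 != 0, c w1 != c w2 & c w1 + c w2 + c w3 != 0].

Lemma independent_labels_moore (F : fieldType) (T J : finType) (grp : T -> J) (a : T -> F)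
    (e : J -> T) (w1 w2 w3 : T) (b1 b2 b3 : F) :
  independent_labels grp a -> (forall j, grp (e j) = j) -> uniq [:: w1; w2; w3] ->
  w1 != e (grp w1) -> w2 != e (grp w2) -> w3 != e (grp w3) ->
  (forall t, (t < 3)%N -> b1 * (a w1 + a (e (grp w1))) ^+ (2 ^ t) +
     b2 * (a w2 + a (e (grp w2))) ^+ (2 ^ t) + b3 * (a w3 + a (e (grp w3))) ^+ (2 ^ t) = 0) ->
  [/\ b1 = 0, b2 = 0 & b3 = 0].
Proof.
move=> indep eK uw n1 n2 n3 eqs; have ind := indep e eK.
have [c1 c12 cs] := ind _ _ _ uw n1 n2 n3.
(* Cyclic rotations of the triple supply the remaining factors of the Moore determinant. *)
have [c2 c23 _] : [/\ a w2 + a (e (grp w2)) != 0, a w2 + a (e (grp w2)) != a w3 + a (e (grp w3)) &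
   a w2 + a (e (grp w2)) + (a w3 + a (e (grp w3))) + (a w1 + a (e (grp w1))) != 0].
  by apply: ind => //; rewrite -(rot_uniq 1) in uw.
have [c3 c31 _] : [/\ a w3 + a (e (grp w3)) != 0, a w3 + a (e (grp w3)) != a w1 + a (e (grp w1)) &
   a w3 + a (e (grp w3)) + (a w1 + a (e (grp w1))) + (a w2 + a (e (grp w2))) != 0].
  by apply: ind => //; rewrite -(rot_uniq 2) in uw.
apply: (moore3 c1 c2 c3 c12 _ c23 cs); first by rewrite eq_sym.
- exact: (eqs 0%N).
- exact: (eqs 1%N).
- exact: (eqs 2%N).
Qed.

(* The section [e] picks the punctured symbol of each group. Adding [a (e (grp o))]
   to the label of [o] does not change the parity sums, as [c] sums to 0 on each
   group, and it kills the label of the punctured symbols. *)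
Lemma light_codeword_eq0 (F : fieldType) (T J : finType) (grp : T -> J) (a : T -> F)
    (e : J -> T) (W : {set T}) (c : T -> F) :
  2%N \in [pchar F] -> independent_labels grp a -> (forall j, grp (e j) = j) ->
  #|W| = 3%N -> (forall o, o \in W -> o != e (grp o)) ->
  (forall o, o \notin W -> o != e (grp o) -> c o = 0) ->
  (forall j, \sum_(o | grp o == j) c o = 0) ->
  (forall t, (t < 3)%N -> \sum_o c o * a o ^+ (2 ^ t) = 0) ->
  forall o, c o = 0.
Proof.
move=> F2 indep eK W3 We cW csum cpar.
pose d o := a o + a (e (grp o)).
have dpar t : (t < 3)%N -> \sum_(o in W) c o * d o ^+ (2 ^ t) = 0.
  move=> t3; rewrite big_mkcond /=.
  transitivity (\sum_o (c o * a o ^+ (2 ^ t) + c o * a (e (grp o)) ^+ (2 ^ t))).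
    apply: eq_bigr => o _; rewrite -mulrDr -exprD_pchar2 //.
    case: ifPn => // oW; case: (eqVneq o (e (grp o))) => [|/cW->//]; last by rewrite mul0r.
    by move=> <-; rewrite addrr_pchar2 // expr0n expn_eq0 mulr0.
  rewrite big_split /= cpar // add0r (partition_big grp predT) //= big1 // => j _.
  rewrite (eq_bigr (fun o => c o * a (e j) ^+ (2 ^ t))) => [|o /eqP->] //.
  by rewrite -mulr_suml csum mul0r.
(* The three equations left on [W] form a Moore system in the three elements of [W]. *)
have c0 o : o != e (grp o) -> c o = 0.
  have := enum_uniq W; have := mem_enum W.
  have : forall t, (t < 3)%N -> \sum_(o' <- enum W) c o' * d o' ^+ (2 ^ t) = 0.
    by move=> t t3; rewrite big_enum; apply: dpar.
  move: W3; rewrite cardE.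
  case: (enum W) => [|w1 [|w2 [|w3 []]]] //= _ dpar' memW uw oe.
  have [||||b1 b2 b3] := @independent_labels_moore _ _ _ grp a e w1 w2 w3 (c w1) (c w2) (c w3) indep eK uw.
  - by apply: We; rewrite -memW !inE eqxx.
  - by apply: We; rewrite -memW !inE eqxx ?orbT.
  - by apply: We; rewrite -memW !inE eqxx ?orbT.
  - by move=> t /dpar'; rewrite !big_cons big_nil addr0 addrA.
  case oW: (o \in W); last by apply: cW; rewrite ?oW.
  by move: oW; rewrite -memW !inE => /or3P[] /eqP->.
(* A punctured symbol is the only term of its group's zero sum not yet known to vanish. *)
move=> o; case: (eqVneq o (e (grp o))) => [->|/c0//].
move: (grp o) => j; have := csum j; rewrite (bigD1 (e j)) ?eK //= big1 ?addr0 // => i /andP[/eqP <-].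
exact: c0.
Qed.

(** * From labels to a maximally recoverable code *)

Definition site_group (n l : nat) (g : 'I_n -> 'I_l) (o : 'I_(n + l)) : 'I_l :=
  match split o with inl i => g i | inr j => j end.

(** Label 0 keeps the local parities out of the parity equations, so these can be summed over all
    coordinates. *)
Definition site_label (F : fieldType) (n l : nat) (a : 'I_n -> F) (o : 'I_(n + l)) : F :=
  match split o with inl i => a i | inr _ => 0 end.

Lemma site_group_lshift (n l : nat) (g : 'I_n -> 'I_l) (i : 'I_n) :
  site_group g (lshift l i) = g i.
Proof. by rewrite /site_group -[lshift l i]/(unsplit (inl i)) unsplitK. Qed.

Lemma site_group_rshift (n l : nat) (g : 'I_n -> 'I_l) (j : 'I_l) :
  site_group g (rshift n j) = j.
Proof. by rewrite /site_group -[rshift n j]/(unsplit (inr j)) unsplitK. Qed.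

Lemma site_label_lshift (F : fieldType) (n l : nat) (a : 'I_n -> F) (i : 'I_n) :
  site_label a (lshift l i) = a i.
Proof. by rewrite /site_label -[lshift l i]/(unsplit (inl i)) unsplitK. Qed.

Lemma site_label_rshift (F : fieldType) (n l : nat) (a : 'I_n -> F) (j : 'I_l) :
  site_label a (rshift n j) = 0.
Proof. by rewrite /site_label -[rshift n j]/(unsplit (inr j)) unsplitK. Qed.

Lemma local_groupE (k r h : nat) (g : 'I_(k + h) -> 'I_(nlocal k r h)) j :
  local_group g j = [set o | site_group g o == j].
Proof.
apply/setP=> o; rewrite !inE -(splitK o); case: (split o) => i /=.
- rewrite site_group_lshift mem_imset ?inE; last exact: lshift_inj.
  by rewrite eq_lrshift orbF.
- rewrite site_group_rshift (inj_eq (@rshift_inj _ _)).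
  by case: imsetP => // -[x _ /eqP]; rewrite eq_rlshift.
Qed.

(** The parity equations can be solved for the heavy symbols because the 3 x 3 Moore block at the
    heavy positions is invertible. *)
Lemma heavy_parity_exists (F : fieldType) (k l : nat) (g : 'I_(k + 3) -> 'I_l) (a : 'I_(k + 3) -> F) :
  independent_labels (site_group g) (site_label a) ->
  exists Hp : 'M[F]_(k, 3),
    row_mx 1%:M Hp *m (\matrix_(i < k + 3, t < 3) a i ^+ (2 ^ t)) = 0.
Proof.
move=> indep; set H := \matrix_(i, t) _.
have uH : dsubmx H \in unitmx.
  rewrite -row_free_unit; apply: inj_row_free => v vH.
  have eqs (t : 'I_3) : v 0 0 * a (rshift k 0) ^+ (2 ^ t) + v 0 1 * a (rshift k 1) ^+ (2 ^ t)
      + v 0 2%:R * a (rshift k 2%:R) ^+ (2 ^ t) = 0.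
    move/rowP/(_ t): vH; rewrite !mxE !big_ord_recl big_ord0 addr0 addrA !mxE => <-.
    by congr (_ + _ * _ ^+ _ + _ * _ ^+ _);
      (congr (v 0 _) || congr (a (rshift k _))); apply: val_inj.
  pose s (j : 'I_3) := lshift l (rshift k j).
  (* The section [rshift] punctures every local parity. Those have label 0, so the shifted labels
     are the labels [a] themselves. *)
  have [||||||b0 b1 b2] := @independent_labels_moore _ _ _ _ _ (@rshift (k + 3) l)
    (s 0) (s 1) (s 2%:R) (v 0 0) (v 0 1) (v 0 2%:R) indep.
  - exact: site_group_rshift.
  - by rewrite /= !inE !(inj_eq (@lshift_inj _ _)) !(inj_eq (@rshift_inj _ _)).
  - by rewrite eq_lrshift.
  - by rewrite eq_lrshift.
  - by rewrite eq_lrshift.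
  - by move=> t t3; rewrite !site_label_rshift !site_label_lshift !addr0; apply: (eqs (Ordinal t3)).
  apply/rowP=> -[[|[|[|//]]] j3]; rewrite mxE.
  - by rewrite -[RHS]b0; congr (v 0 _); apply: val_inj.
  - by rewrite -[RHS]b1; congr (v 0 _); apply: val_inj.
  - by rewrite -[RHS]b2; congr (v 0 _); apply: val_inj.
exists (- (usubmx H *m invmx (dsubmx H))).
by rewrite -[H in X in _ *m X]vsubmxK mul_row_col mul1mx mulNmx mulmxKV // subrr.
Qed.

(** A message whose punctured codeword has weight at most 3 yields a full codeword [c] to which
    [light_codeword_eq0] applies; its systematic part then shows that the message is zero. *)
Lemma maximally_recoverable_of_labels (F : fieldType) (k r : nat)
    (g : 'I_(k + 3) -> 'I_(nlocal k r 3)) (a : 'I_(k + 3) -> F) (Hp : 'M[F]_(k, 3)) :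
  (0 < k)%N -> 2%N \in [pchar F] ->
  independent_labels (site_group g) (site_label a) ->
  row_mx 1%:M Hp *m (\matrix_(i < k + 3, t < 3) a i ^+ (2 ^ t)) = 0 ->
  maximally_recoverable Hp g.
Proof.
move=> k0 F2 indep; set H := \matrix_(i, t) _ => SH E E1.
have /fin_all_exists[e eP] j : exists o, E :&: local_group g j = [set o].
  by apply/cards1P/eqP.
have eK j : site_group g (e j) = j.
  have : e j \in E :&: local_group g j by rewrite eP set11.
  by rewrite local_groupE !inE => /andP[_ /eqP].
have inE_e o : (o \in E) = (o == e (site_group g o)).
  by rewrite -[RHS]in_set1 -eP local_groupE !inE eqxx andbT.
have cardE : #|~: E| = (k + 3)%N.
  have -> : E = e @: setT.
    apply/setP=> o; rewrite inE_e; apply/eqP/imsetP => [->|[j _ ->]]; last by rewrite eK.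
    by exists (site_group g o).
  rewrite cardsCs setCK card_imset ?cardsT ?card_ord ?addnK //.
  by apply: can_inj eK.
split=> //; apply: MDS_code_of_wt => // [|x x0]; first by rewrite cardE leq_addr.
have -> : (#|~: E| - k = 3)%N by rewrite cardE addnC addnK.
rewrite ltnNge; apply: contraNN x0 => wt3.
rewrite /puncture mulmx_colsub in wt3.
pose c o := (x *m local_gen Hp g) 0 o.
pose S := row_mx 1%:M Hp; pose s i := (x *m S) 0 i.
have cl i : c (lshift _ i) = s i by rewrite /c mul_mx_row row_mxEl.
have cr j : c (rshift _ j) = \sum_(i | g i == j) s i.
  rewrite /c mul_mx_row row_mxEr mulmxA mxE [RHS]big_mkcond; apply: eq_bigr => i _.
  by rewrite [X in _ * X]mxE; case: eqP; rewrite ?mulr1 ?mulr0.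
have csum j : \sum_(o | site_group g o == j) c o = 0.
  rewrite big_split_ord /=.
  under eq_bigl => i do rewrite site_group_lshift.
  under eq_bigr => i _ do rewrite cl.
  under [X in _ + X]eq_bigl => i do rewrite site_group_rshift.
  by rewrite big_pred1_eq cr addrr_pchar2.
have cpar t : (t < 3)%N -> \sum_o c o * site_label a o ^+ (2 ^ t) = 0.
  move=> t3; rewrite big_split_ord /= [X in _ + X]big1 ?addr0 => [|j _]; last first.
    by rewrite site_label_rshift expr0n expn_eq0 mulr0.
  have : (x *m S *m H) 0 (Ordinal t3) = 0 by rewrite -mulmxA SH mulmx0 mxE.
  rewrite mxE => xSH; rewrite -[RHS]xSH; apply: eq_bigr => i _.
  by rewrite site_label_lshift cl [H _ _]mxE.
pose A := [set o in ~: E | c o != 0].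
have cardA : (#|A| <= 3)%N.
  apply: leq_trans wt3; rewrite /wt -(card_imset _ enum_val_inj); apply: subset_leq_card.
  apply/subsetP=> o; rewrite inE => /andP[oE co]; apply/imsetP.
  exists (enum_rank_in oE o); last by rewrite enum_rankK_in.
  by rewrite inE mxE enum_rankK_in.
have AE : A \subset ~: E by apply/subsetP=> o; rewrite inE => /andP[].
(* The support [A] may have fewer than three elements; it is padded inside the complement of [E],
   since the Moore argument uses exactly three positions. *)
have [|W [AW WE W3]] := @intermediate_card _ A (~: E) (3 - #|A|) AE.
  by rewrite subnKC // cardE leq_addl.
rewrite subnKC // in W3.
have c0 : forall o, c o = 0.
  apply: (light_codeword_eq0 F2 indep eK W3) => // [o /(subsetP WE)|o oW oe].
    by rewrite inE inE_e.
  apply/eqP; apply: contraNT oW => co; apply: (subsetP AW).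
  by rewrite !inE inE_e oe.
apply/eqP/rowP=> i; rewrite mxE.
have := c0 (lshift _ (lshift _ i)).
by rewrite cl /s /S mul_mx_row row_mxEl mulmx1.
Qed.

(** * Subfields and elementary abelian 2-groups *)

(** ['X^q - 'X] divides ['X^(q ^ e) - 'X], the product of all ['X - x%:P], so it splits into
    distinct linear factors. *)
Lemma card_pow_fixed (K : finFieldType) (q e : nat) :
  (1 < q)%N -> #|K| = (q ^ e)%N -> #|[set x : K | x ^+ q == x]| = q.
Proof.
move=> q1 cardK; have q0 := ltnW q1.
pose P : {poly K} := 'X^q - 'X.
have Pfact n : (0 < n)%N -> 'X^n - 'X = 'X * ('X^(n.-1) - 1) :> {poly K}.
  by move=> n0; rewrite mulrBr mulr1 -exprS prednK.
have sizeP : size P = q.+1 by rewrite size_polyDl size_polyXn // size_polyN size_polyX.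
have : P %| \prod_(x : K) ('X - x%:P).
  (* After removing a factor ['X] from both, divisibility follows from [q - 1] dividing
     [q ^ e - 1]. *)
  rewrite -finField_genPoly cardK /P !Pfact ?expn_gt0 ?q0 // predn_exp exprM [X in _ %| _ * X]subrX1 mulrA.
  exact: dvdp_mulr.
case/dvdp_prod_XsubC=> b; set s := mask b _ => Ps.
have us : uniq s by apply: mask_uniq; apply: index_enum_uniq.
have /eqP := eqp_size Ps; rewrite sizeP size_prod_XsubC eqSS => /eqP sizes.
rewrite [RHS]sizes -(card_uniqP us); apply: eq_card => x.
rewrite inE -(root_prod_XsubC s) -(eqp_root Ps) /root /P !hornerE.
by rewrite subr_eq0.
Qed.

Definition elementary2 (V : finZmodType) (G : {set V}) : Prop :=
  [/\ 0 \in G, {in G &, forall x y, x + y \in G} & {in G, forall x, x + x = 0}].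

Lemma elementary2_abelem (V : finZmodType) (G : {set V}) :
  elementary2 G -> exists2 G' : {group V}, G' = G :> {set V} & (2.-abelem G')%g.
Proof.
case=> G0 GD G2; have gG : group_set G by apply/group_setP; split.
exists (Group gG) => //; apply/abelemP => //; split; first exact: FinRing.zmod_abelian.
by move=> x xG; rewrite FinRing.zmodXgE mulr2n; apply: G2.
Qed.

(** Elementary abelian 2-groups of equal order are isomorphic. The map is total on [V] but
    controlled only on [G]. *)
Lemma elementary2_embedding (V W : finZmodType) (G : {set V}) (H : {set W}) :
  elementary2 G -> elementary2 H -> #|G| = #|H| ->
  exists f : V -> W, [/\ {in G &, {morph f : x y / x + y}}, {in G &, injective f}
    & forall x, x \in G -> f x \in H].
Proof.
case/elementary2_abelem=> G' <- abG; case/elementary2_abelem=> H' <- abH cardGH.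
have : G' \isog H' by rewrite (isog_abelem_card _ abG) abH cardGH /=.
case/isogP=> f injf im; exists f; split.
- by move=> x y xG yG; apply: (morphM f).
- exact/injmP.
- by move=> x xG; rewrite -im; apply: mem_morphim.
Qed.

Lemma elementary2T (V : finZmodType) : (forall x : V, x + x = 0) -> elementary2 [set: V].
Proof. by move=> V2; split=> [|x y _ _|x _]; rewrite ?inE. Qed.

Lemma elementary2_row (n : nat) : elementary2 [set: 'rV['F_2]_n].
Proof. by apply: elementary2T => x; apply/matrixP=> i j; rewrite !mxE addrr_pchar2 ?pchar_Fp. Qed.

Lemma card_row_F2 (n : nat) : #|[set: 'rV['F_2]_n]| = (2 ^ n)%N.
Proof. by rewrite cardsT card_mx card_Fp // mul1n. Qed.

(** All spaces pass through row vectors over GF(2): the coordinates of the three components are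
    concatenated and sent to [F]. This realizes the label space inside [F]. *)
Lemma triple_embedding (F K : finFieldType) (n1 n2 n3 : nat) (A X Y : {set K}) :
  2%N \in [pchar F] -> elementary2 A -> elementary2 X -> elementary2 Y ->
  #|A| = (2 ^ n1)%N -> #|X| = (2 ^ n2)%N -> #|Y| = (2 ^ n3)%N ->
  #|F| = (2 ^ (n1 + n2 + n3))%N ->
  exists f : K -> K -> K -> F,
    (forall a x y a' x' y', a \in A -> x \in X -> y \in Y -> a' \in A -> x' \in X -> y' \in Y ->
       f (a + a') (x + x') (y + y') = f a x y + f a' x' y') /\
    (forall a x y, a \in A -> x \in X -> y \in Y -> f a x y = 0 -> [/\ a = 0, x = 0 & y = 0]).
Proof.
move=> F2 A2 X2 Y2 cA cX cY cF.
have [|fA [fAD fAi _]] := elementary2_embedding A2 (elementary2_row n1); first by rewrite card_row_F2.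
have [|fX [fXD fXi _]] := elementary2_embedding X2 (elementary2_row n2); first by rewrite card_row_F2.
have [|fY [fYD fYi _]] := elementary2_embedding Y2 (elementary2_row n3); first by rewrite card_row_F2.
have F2' : elementary2 [set: F] by apply: elementary2T => x; apply: addrr_pchar2.
have [|fF [fFD fFi _]] := elementary2_embedding (elementary2_row (n1 + n2 + n3)) F2'.
  by rewrite card_row_F2 cardsT cF.
pose f a x y := fF (row_mx (row_mx (fA a) (fX x)) (fY y)).
have fD a x y a' x' y' : a \in A -> x \in X -> y \in Y -> a' \in A -> x' \in X -> y' \in Y ->
    f (a + a') (x + x') (y + y') = f a x y + f a' x' y'.
  by move=> *; rewrite /f fAD // fXD // fYD // -!add_row_mx fFD ?inE.
have [[A0 _ _] [X0 _ _] [Y0 _ _]] := And3 A2 X2 Y2.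
have f0 : f 0 0 0 = 0.
  by apply: (addrI (f 0 0 0)); rewrite -fD // !addr0.
exists f; split=> // a x y aA xX yY.
rewrite -f0 => /fFi; rewrite !inE => /(_ isT isT) /eq_row_mx[] /eq_row_mx[].
by move=> /fAi-> // /fXi-> // /fYi->.
Qed.

(** * Independent labels from a cap *)

(** These are the GF(2)-coordinates of the first label component: a standard basis vector per
    position, and zero at a local parity. *)
Definition site_vector (n l r : nat) (p : 'I_n -> 'I_r) (o : 'I_(n + l)) : 'rV['F_2]_r :=
  match split o with inl i => delta_mx 0 (p i) | inr _ => 0 end.

(** A group has a single local parity, so [o1] or [o2] is a data or heavy symbol; the coordinate at
    its position is 1 there and 0 at the other three sites. *)
Lemma site_vector4 (n l r : nat) (g : 'I_n -> 'I_l) (p : 'I_n -> 'I_r) (o1 o2 o3 o4 : 'I_(n + l)) :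
  (forall i i', g i = g i' -> p i = p i' -> i = i') -> uniq [:: o1; o2; o3; o4] ->
  site_group g o2 = site_group g o1 -> site_group g o3 = site_group g o1 ->
  site_group g o4 = site_group g o1 ->
  site_vector p o1 + site_vector p o2 + site_vector p o3 + site_vector p o4 != 0.
Proof.
move=> gp.
have coord i o : site_group g o = g i -> o != lshift l i -> site_vector p o 0 (p i) = 0.
  rewrite /site_group /site_vector -{2}(splitK o); case: (split o) => /= [i' gi|j _ _]; last by rewrite mxE.
  rewrite (inj_eq (@lshift_inj _ _)) mxE eqxx /= => ii'.
  by case: (p i =P p i') => // pi; case/eqP: ii'; apply: gp.
have coord1 i : site_vector p (lshift l i) 0 (p i) = 1.
  by rewrite /site_vector -[lshift l i]/(unsplit (inl i)) unsplitK mxE !eqxx.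
rewrite /= !inE !negb_or -!andbA => /and4P[n12 n13 n14 /and3P[n23 n24 _]] g2 g3 g4.
apply/negP=> /eqP/rowP s0.
case E1: (split o1) => [i|j].
  have o1E : o1 = lshift l i by rewrite -(splitK o1) E1.
  have gi : site_group g o1 = g i by rewrite o1E site_group_lshift.
  move/(_ (p i)): s0; rewrite !mxE (coord i o2) ?(coord i o3) ?(coord i o4) ?g2 ?g3 ?g4 // -?o1E;
    try by rewrite eq_sym.
  by rewrite o1E coord1.
case E2: (split o2) => [i|j'].
  have o2E : o2 = lshift l i by rewrite -(splitK o2) E2.
  have gi : site_group g o2 = g i by rewrite o2E site_group_lshift.
  move/(_ (p i)): s0; rewrite !mxE (coord i o1) ?(coord i o3) ?(coord i o4) ?g3 ?g4 -?g2 // -?o2E //;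
    try by rewrite eq_sym.
  by rewrite o2E coord1.
case/eqP: n12; move: g2; rewrite -(splitK o1) -(splitK o2) E1 E2 /= !site_group_rshift.
by move=> ->.
Qed.

Lemma site_vector_inj (n l r : nat) (g : 'I_n -> 'I_l) (p : 'I_n -> 'I_r) (o1 o2 : 'I_(n + l)) :
  (forall i i', g i = g i' -> p i = p i' -> i = i') ->
  site_group g o1 = site_group g o2 -> site_vector p o1 = site_vector p o2 -> o1 = o2.
Proof.
move=> gp; rewrite /site_group /site_vector -{3}(splitK o1) -{3}(splitK o2).
have ne0 (i : 'I_r) : (delta_mx 0 i : 'rV['F_2]_r) != 0.
  by apply/eqP=> /rowP/(_ i)/eqP; rewrite !mxE !eqxx.
case: (split o1) (split o2) => [i|j] [i'|j'] /=.
- move=> gi /rowP/(_ (p i)); rewrite !mxE !eqxx /= => pi.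
  by congr (lshift _ _); apply: gp => //; case: (p i =P p i') pi.
- by move=> _ /eqP; rewrite (negPf (ne0 _)).
- by move=> _ /esym/eqP; rewrite (negPf (ne0 _)).
- by move=> ->.
Qed.

(* The second clause says that no three points [(vx s, vy s)] are on a line over [A],
   which stands for a subfield of [K]. *)
Definition cap_points (K : finFieldType) (A : {set K}) (l : nat) (vx vy : 'I_l -> K) : Prop :=
  injective vx /\
  forall a1 a2 a3 s1 s2 s3, a1 \in A -> a2 \in A -> a3 \in A ->
    a1 != 0 -> a2 != 0 -> a3 != 0 -> uniq [:: s1; s2; s3] ->
    a1 + a2 + a3 = 0 -> a1 * vx s1 + a2 * vx s2 + a3 * vx s3 = 0 ->
    a1 * vy s1 + a2 * vy s2 + a3 * vy s3 != 0.

(** Puncturing preserves the shape [F3 b s] of a label, with [b] nonzero off the punctured symbols.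
    A vanishing sum therefore splits into one equation per component. *)
Lemma independent_labels_of_cap (F K : finFieldType) (n l r n2 n3 : nat) (A X Y : {set K})
    (vx vy : 'I_l -> K) (g : 'I_n -> 'I_l) (p : 'I_n -> 'I_r) :
  2%N \in [pchar F] -> 2%N \in [pchar K] ->
  elementary2 A -> elementary2 X -> elementary2 Y ->
  #|A| = (2 ^ r)%N -> #|X| = (2 ^ n2)%N -> #|Y| = (2 ^ n3)%N ->
  #|F| = (2 ^ (r + n2 + n3))%N ->
  (forall a s, a \in A -> a * vx s \in X) -> (forall a s, a \in A -> a * vy s \in Y) ->
  cap_points A vx vy ->
  (forall i i', g i = g i' -> p i = p i' -> i = i') ->
  exists a : 'I_n -> F, independent_labels (site_group g) (site_label a).
Proof.
move=> F2 K2 A2 X2 Y2 cA cX cY cF AX AY [vx_inj cap] gp.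
have [f [fD f0]] := triple_embedding F2 A2 X2 Y2 cA cX cY cF.
have [|h [hD hi hA]] := elementary2_embedding (elementary2_row r) A2; first by rewrite card_row_F2.
have [[A0 AD _] [X0 XD _] [Y0 YD _]] := And3 A2 X2 Y2.
have h0 : h 0 = 0 by apply: (addrI (h 0)); rewrite -hD ?inE // !addr0.
have {}hD : {morph h : x y / x + y} by move=> x y; rewrite hD ?inE.
have {}hA x : h x \in A by apply: hA; rewrite inE.
have h_eq0 x : h x = 0 -> x = 0 by rewrite -h0; apply: hi; rewrite inE.
have fz : f 0 0 0 = 0 by apply: (addrI (f 0 0 0)); rewrite -fD // !addr0.
pose G := site_group g; pose u := @site_vector n l r p.
pose F3 a s := f a (a * vx s) (a * vy s).
have F3D a a' s : a \in A -> a' \in A -> F3 (a + a') s = F3 a s + F3 a' s.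
  by move=> aA aA'; rewrite /F3 !mulrDl fD ?AX ?AY.
exists (fun i => F3 (h (delta_mx 0 (p i))) (g i)).
set lab := site_label _.
have labE o : lab o = F3 (h (u o)) (G o).
  rewrite /lab /site_label /u /site_vector /G /site_group; case: (split o) => // j.
  by rewrite h0 /F3 !mul0r fz.
move=> e; rewrite -/G => eK c w1 w2 w3; rewrite /= !inE negb_or andbT => /andP[/andP[w12 w13] w23] nw1 nw2 nw3.
pose b w := h (u w + u (e (G w))).
have bA w : b w \in A by apply: hA.
have cE w : c w = F3 (b w) (G w) by rewrite /c !labE eK -F3D // -hD.
have row2 (x : 'rV['F_2]_r) : x + x = 0 by have [_ _ ->] := elementary2_row r; rewrite ?inE.
have row_eq (x y : 'rV['F_2]_r) : x + y = 0 -> x = y.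
  by move=> xy; apply: (addIr y); rewrite xy row2.
have b0 w : w != e (G w) -> b w != 0.
  apply: contraNneq => /h_eq0/row_eq uw; apply/eqP; apply: (site_vector_inj gp) uw.
  by rewrite -/G eK.
have K_eq (x y : K) : x + y = 0 -> x = y.
  by move=> xy; apply: (addIr y); rewrite xy addrr_pchar2.
have F3_0 a s : a \in A -> F3 a s = 0 -> a = 0.
  by move=> aA /f0[]; rewrite ?AX ?AY.
have b_inj w w' : G w = G w' -> b w = b w' -> w = w'.
  move=> Gw; rewrite /b Gw => /hi; rewrite !inE => /(_ isT isT)/addIr.
  exact: (site_vector_inj gp).
split.
- by rewrite cE; apply: contraNneq (b0 _ nw1) => /F3_0 ->.
- apply: contraNneq w12; rewrite !cE => c12; apply/eqP.
  have : F3 (b w1) (G w1) + F3 (b w2) (G w2) = 0 by rewrite c12 addrr_pchar2.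
  rewrite /F3 -fD ?AX ?AY // => /f0; rewrite !(AD, XD, YD, AX, AY) //.
  case=> // /K_eq b12 /K_eq; rewrite b12 => /(mulfI (b0 _ nw2))/vx_inj G12 _.
  exact: b_inj.
rewrite !cE /F3 -fD ?AX ?AY // -fD ?AX ?AY ?AD ?XD ?YD ?AX ?AY //.
apply/eqP=> /f0; rewrite !(AD, XD, YD, AX, AY) //; case=> // sb sx sy.
(* If exactly two symbols share a group, the first equation merges their coefficients into [b k];
   the second then equates [vx] at two distinct groups. *)
have pair i j k : G i = G j -> G j <> G k -> k != e (G k) ->
    b i + b j + b k = 0 -> b i * vx (G i) + b j * vx (G j) + b k * vx (G k) = 0 -> False.
  move=> Gij Gjk nk; rewrite Gij -mulrDl => /K_eq -> /K_eq.
  by move/(mulfI (b0 _ nk))/vx_inj.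
case: (eqVneq (G w1) (G w2)) => [G12|G12].
  case: (eqVneq (G w2) (G w3)) => [G23|/eqP G23]; last exact: (pair w1 w2 w3).
  move: nw1 nw2; rewrite G12 G23 => nw1 nw2.
  (* With all three symbols in one group, the vector of the punctured symbol occurs three times and
     so survives once, giving four distinct sites. *)
  have : u w1 + u w2 + u w3 + u (e (G w3)) != 0.
    apply: (site_vector4 (g := g)) => //; rewrite -/G ?eK ?G12 ?G23 //.
    by rewrite /= !inE !negb_or w12 w13 w23 nw1 nw2 nw3.
  case/eqP; apply: h_eq0; rewrite -[RHS]sb /b -!hD G12 G23.
  by rewrite [u w1 + _ + (_ + _)]addrACA row2 addr0 addrA.
case: (eqVneq (G w1) (G w3)) => [G13|G13].
  apply: (pair w1 w3 w2) => //; first by move=> G32; rewrite G13 G32 eqxx in G12.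
  - by rewrite addrAC.
  - by rewrite addrAC.
case: (eqVneq (G w2) (G w3)) => [G23|G23].
  apply: (pair w2 w3 w1) => //; first by move=> G31; rewrite G31 eqxx in G13.
  - by rewrite addrC addrA.
  - by rewrite addrC addrA.
have /eqP[] : b w1 * vy (G w1) + b w2 * vy (G w2) + b w3 * vy (G w3) != 0 by
  apply: cap; rewrite ?b0 //= !inE negb_or G12 G13 G23.
by [].
Qed.

(** * The elliptic paraboloid *)

(** Here [m] is half the even exponent of the theorem. Coefficients in GF(q) are fixed by the power
    [Q], so a linear relation between the [x_i] also holds between the [x_i ^+ Q], and elimination
    is possible. *)
Lemma paraboloid_cap (K : finFieldType) (r m l : nat) :
  2%N \in [pchar K] -> #|K| = (2 ^ (r * m * 2))%N -> (l <= #|K|)%N ->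
  exists vx : 'I_l -> K,
    cap_points [set a : K | a ^+ (2 ^ r) == a] vx (fun s => vx s ^+ (2 ^ (r * m)).+1).
Proof.
move=> K2 cK lK; pose vx (s : 'I_l) : K := enum_val (widen_ord lK s).
exists vx; set Q := (2 ^ (r * m))%N.
have vx_inj : injective vx by move=> s s' /enum_val_inj [ss']; apply: val_inj.
split=> // a1 a2 a3 s1 s2 s3.
have AQ a : a \in [set a : K | a ^+ (2 ^ r) == a] -> a ^+ Q = a.
  rewrite inE /Q expnM => /eqP aq; elim: (m) => [|m' IH]; first by rewrite expn0 expr1.
  by rewrite expnS exprM aq.
move=> /AQ a1Q /AQ a2Q /AQ a3Q _ a20 _; rewrite /= !inE negb_or andbT => /andP[/andP[s12 _] s23].
move=> sa sx; apply/eqP=> sy.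
move: (vx s1) (vx s2) (vx s3) sx sy (inj_eq vx_inj s1 s2) (inj_eq vx_inj s2 s3) => x1 x2 x3 sx sy.
rewrite (negPf s12) (negPf s23) => /negP x12 /negP x23.
have sxQ : a1 * x1 ^+ Q + a2 * x2 ^+ Q + a3 * x3 ^+ Q = 0.
  have /(congr1 (fun x => x ^+ Q)) := sx.
  by rewrite !exprD_pchar2 // !exprMn a1Q a2Q a3Q expr0n expn_eq0.
(* This combination of the four relations cancels [a1] and [a3], and the coefficient of [a2]
   factors. *)
have : a2 * (x2 - x3) * (x2 ^+ Q - x1 ^+ Q) =
  (a1 * x1 ^+ Q.+1 + a2 * x2 ^+ Q.+1 + a3 * x3 ^+ Q.+1) - (a1 * x1 + a2 * x2 + a3 * x3) * x1 ^+ Q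
  - x3 * (a1 * x1 ^+ Q + a2 * x2 ^+ Q + a3 * x3 ^+ Q) + (a1 + a2 + a3) * x3 * x1 ^+ Q.
  by rewrite !exprS; move: (x1 ^+ Q) (x2 ^+ Q) (x3 ^+ Q) => y1 y2 y3; ring.
rewrite sy sx sxQ sa !mul0r mulr0 !subr0 addr0 => /eqP.
rewrite !mulf_eq0 (negPf a20) !subr_eq0 => /orP[/x23 //|/eqP x12Q].
case: x12; rewrite -subr_eq0.
have : (x1 - x2) ^+ Q == 0 by rewrite oppr_pchar2 // exprD_pchar2 // x12Q addrr_pchar2.
by rewrite expf_eq0 => /andP[].
Qed.

(** * Grouping, choice of fields and assembly *)

(** The groups are consecutive blocks; [p] is the position within a block, which selects the basis
    element. *)
Lemma grouping_exists (n r l : nat) : n = (l * r)%N ->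
  exists (g : 'I_n -> 'I_l) (p : 'I_n -> 'I_r),
    (forall i i', g i = g i' -> p i = p i' -> i = i') /\
    (forall j, #|[set i | g i == j]| = r).
Proof.
move=> nE.
have r0 (i : 'I_n) : (0 < r)%N by case: r nE i => // ->; rewrite muln0 => -[].
have gP (i : 'I_n) : (i %/ r < l)%N by rewrite ltn_divLR ?(r0 i) // -nE.
have pP (i : 'I_n) : (i %% r < r)%N by rewrite ltn_pmod ?(r0 i).
have qP (j : 'I_l) (c : 'I_r) : (j * r + c < n)%N.
  rewrite nE (leq_trans _ (leq_mul (ltn_ord j) (leqnn r))) // mulSn addnC.
  by rewrite ltn_add2r ltn_ord.
exists (fun i => Ordinal (gP i)), (fun i => Ordinal (pP i)); split.
  by move=> i i' [gi] [pi]; apply: val_inj; rewrite /= (divn_eq i r) gi pi -divn_eq.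
move=> j; rewrite -[RHS]card_ord -(card_imset _ (f := fun c => Ordinal (qP j c))).
  apply: eq_card => i; rewrite inE; apply/eqP/imsetP => [[gi]|[c _ ->]].
    by exists (Ordinal (pP i)) => //; apply: val_inj; rewrite /= -gi -divn_eq.
  apply: val_inj; rewrite /= divnMDl ?divn_small ?addn0 //.
  exact: leq_ltn_trans (ltn_ord c).
by move=> c c' [/addnI cc']; apply: val_inj.
Qed.

Lemma cap_exists (r m' l : nat) : (0 < r)%N -> (l <= 2 ^ (r * m' * 2))%N ->
  exists (K : finFieldType) (A X Y : {set K}) (vx vy : 'I_l -> K),
  [/\ 2%N \in [pchar K], [/\ elementary2 A, elementary2 X & elementary2 Y],
      [/\ #|A| = 2 ^ r, #|X| = 2 ^ (r * m' * 2) & #|Y| = 2 ^ (r * m')]%N,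
      (forall a s, a \in A -> a * vx s \in X) /\ (forall a s, a \in A -> a * vy s \in Y)
    & cap_points A vx vy].
Proof.
move=> r0; have exp2_gt1 q : (0 < q)%N -> (1 < 2 ^ q)%N.
  by move=> q0; rewrite -{1}(expn0 2) ltn_exp2l.
have elem2 (K : finFieldType) (q : nat) :
    2%N \in [pchar K] -> elementary2 [set x : K | x ^+ (2 ^ q) == x].
  move=> K2; split=> [|x y|x _]; rewrite ?addrr_pchar2 // !inE.
    by rewrite expr0n expn_eq0.
  by move=> /eqP xq /eqP yq; rewrite exprD_pchar2 // xq yq.
(* For [m' = 0] the cap is a single point of a zero-dimensional space, but GF(Q^2) = GF(1)
   does not exist, so [K] is GF(q) and [X], [Y] are trivial. *)
case: (posnP m') => [->|m0]; rewrite ?(muln0, mul0n) => lK.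
  have [K K2 cK] := @pPrimePowerField 2 r isT r0.
  exists K, [set: K], [set 0], [set 0], (fun=> 0), (fun=> 0).
  have E0 : elementary2 [set 0 : K].
    by split=> [|x y /set1P-> /set1P->|x /set1P->]; rewrite ?addr0 ?set11.
  have s_eq (s s' : 'I_l) : s = s'.
    apply: val_inj; case: s s' => [[|s] sl] [[|s'] s'l] //=.
    - by have := leq_trans s'l lK.
    - by have := leq_trans sl lK.
    - by have := leq_trans sl lK.
  split=> //.
  - by split=> //; apply: elementary2T => x; rewrite addrr_pchar2.
  - by rewrite cardsT cK !cards1.
  - by split=> a s _; rewrite mulr0 inE.
  - split=> [s s' _|a1 a2 a3 s1 s2 s3 _ _ _ _ _ _]; first exact: s_eq.
    by rewrite (s_eq s1 s2) /= inE eqxx.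
have [|K K2 cK] := @pPrimePowerField 2 (r * m' * 2) isT; first by rewrite !muln_gt0 r0 m0.
have [|vx cap] := paraboloid_cap (l := l) K2 cK; first by rewrite cK.
exists K, [set a : K | a ^+ (2 ^ r) == a], [set: K], [set a : K | a ^+ (2 ^ (r * m')) == a].
exists vx, (fun s => vx s ^+ (2 ^ (r * m')).+1); split=> //.
- by split; [apply: elem2|apply: elementary2T => x; rewrite addrr_pchar2|apply: elem2].
- split; last by apply: (@card_pow_fixed _ _ 2); rewrite ?cK ?expnM // -?expnM exp2_gt1 // muln_gt0 r0.
    by apply: (@card_pow_fixed _ _ (m' * 2)); rewrite ?cK -?expnM ?mulnA // exp2_gt1.
  by rewrite cardsT cK.
(* The norm [x ^+ Q.+1] lies in GF(Q) because [x ^+ (Q * Q) = x], and GF(q) is contained in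
   GF(Q). *)
split=> [a s _|a s]; rewrite !inE // => /eqP aq; set Q := (2 ^ (r * m'))%N.
have -> : (a * vx s ^+ Q.+1) ^+ Q = a ^+ Q * (vx s ^+ Q * vx s ^+ (Q * Q)).
  by rewrite exprMn; congr (_ * _); rewrite -exprD -exprM mulSn.
have -> : vx s ^+ (Q * Q) = vx s.
  by rewrite -[RHS]expf_card cK [in RHS]expnM -mulnn.
have -> : a ^+ Q = a.
  rewrite /Q expnM; elim: (m') => [|k IH]; first by rewrite expn0 expr1.
  by rewrite expnS exprM aq.
by rewrite exprSr.
Qed.

Theorem theorem17 (k r m : nat) :
  (0 < k)%N -> (0 < r)%N -> (r %| k + 3)%N ->
  ~~ odd m -> ((k + 3) %/ r <= 2 ^ (r * m))%N ->
  (forall m' : nat, ~~ odd m' -> ((k + 3) %/ r <= 2 ^ (r * m'))%N -> (m <= m')%N) ->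
  exists F : finFieldType,
    #|F| = (2 ^ (r * ((3 * m) %/ 2 + 1)))%N /\
    exists (Hp : 'M[F]_(k, 3)) (g : 'I_(k + 3) -> 'I_(nlocal k r 3)),
      valid_grouping g /\ maximally_recoverable Hp g.
Proof.
move=> k0 r0 rk m_even le_l _.
pose m' := m./2; have mE : m = (m' * 2)%N by rewrite muln2 even_halfK.
have [g [p [gp g_valid]]] := @grouping_exists (k + 3) r (nlocal k r 3) (esym (divnK rk)).
(* The summands are the GF(2)-dimensions of GF(q), GF(Q^2) and GF(Q). *)
have tE : (r * ((3 * m) %/ 2 + 1) = r + r * m' * 2 + r * m')%N.
  by rewrite mE mulnA mulnK //; ring.
have [|F F2 cF] := @pPrimePowerField 2 (r * ((3 * m) %/ 2 + 1)) isT.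
  by rewrite muln_gt0 r0 addn1.
exists F; split=> //.
have [|K [A [X [Y [vx [vy]]]]]] := @cap_exists r m' (nlocal k r 3) r0.
  by rewrite -mulnA -mE.
case=> K2 [A2 X2 Y2] [cA cX cY] [AX AY] cap.
rewrite tE in cF.
have [a indep] := independent_labels_of_cap F2 K2 A2 X2 Y2 cA cX cY cF AX AY cap gp.
have [Hp HpH] := heavy_parity_exists indep.
exists Hp, g; split=> //.
exact: maximally_recoverable_of_labels indep HpH.
Qed.
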